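(* Let $1\le p<q<\infty$, $n\ge 1$, $X=\ell^p(A)\oplus\ell^q(B)$ with $A,B$ disjoint copies of $\mathbb N$, and let $V\subset X$ be an $n$-dimensional subspace. Put $\alpha=\dim(V\cap\ell^p(A))$ and $\gamma=\dim(V\cap\ell^q(B))$. Then $$\operatorname{prof}(V)=\{(a,n-a):\ \alpha\le a\le n-\gamma\}:$$ the profile is an interval with no gaps, determined by the two integers $(\alpha,\gamma)$.
   Context: Scalars are complex. Vectors of $X$ are regarded as functions on $A\sqcup B$ (with a fixed total order, say $A$ before $B$). For a basis $v_1,\dots,v_n$ of $V$ and an $n$-element subset $I=\{i_1<\dots<i_n\}\subset A\sqcup B$, put $p_I=\det(v_r(i_s))_{r,s=1}^n$ (well defined up to a common nonzero scalar). For integers $a,b\ge0$ with $a+b=n$, the block of type $(a,b)$ is the family $\beta_{a,b}(V)=(p_I)$ over those $I$ with $|I\cap A|=a$, $|I\cap B|=b$. The profile is $\operatorname{prof}(V)=\{(a,b):a+b=n,\ \beta_{a,b}(V)\neq0\}$. *)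

(* Defs.v *)
From HB Require Import structures.
From mathcomp Require Import all_boot all_order all_algebra.
From mathcomp Require Import finmap complex.
From mathcomp Require Import all_classical all_reals all_analysis.

Set Implicit Arguments.
Unset Strict Implicit.
Unset Printing Implicit Defensive.

Import Order.TTheory GRing.Theory Num.Theory.
Local Open Scope classical_set_scope.
Local Open Scope ring_scope.
Local Open Scope complex_scope.

Section LinearAlgebra.
Context {K : fieldType} {E : lmodType K}.

Definition is_basis (W : set E) (d : nat) (v : 'I_d -> E) : Prop :=
  (forall c : 'I_d -> K, \sum_(i < d) c i *: v i = 0 -> forall i, c i = 0) /\
  W = [set \sum_(i < d) c i *: v i | c in [set: 'I_d -> K]].

(* As [E] may be infinite dimensional, {vspace E} is not available.  The
   default value 0 is used only for subsets without a finite basis. *)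
Definition findim (W : set E) : nat :=
  xget 0%N [set d | exists v : 'I_d -> E, is_basis W v].

End LinearAlgebra.

(* [inl] is A and [inr] is B. *)
Notation AB := (nat + nat)%type.

Definition inA (i : AB) : bool := if i is inl _ then true else false.

Definition leAB (i j : AB) : bool :=
  match i, j with
  | inl k, inl l => (k <= l)%N
  | inl _, inr _ => true
  | inr _, inl _ => false
  | inr k, inr l => (k <= l)%N
  end.

(* [R[i]^o] rather than [R[i]]: the scalars are complex, whereas [R[i]] itself
   carries a vector space structure over [R]. *)
Notation funAB R := (AB -> R[i]^o).

Section Spaces.
Context {R : realType}.

Definition in_ell (p : R) (u : nat -> R[i]) : Prop :=
  (\sum_(0 <= k <oo) (ComplexField.Normc.normc (u k) `^ p)%:E < +oo)%E.

Definition ell_sum (p q : R) : set (funAB R) :=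
  [set x | in_ell p (fun k => x (inl k)) /\ in_ell q (fun k => x (inr k))].

Definition ellA (p : R) : set (funAB R) :=
  [set x | in_ell p (fun k => x (inl k)) /\ forall k, x (inr k) = 0].

Definition ellB (q : R) : set (funAB R) :=
  [set x | (forall k, x (inl k) = 0) /\ in_ell q (fun k => x (inr k))].

(* For [#|` I| = n]: the columns are indexed by the elements of [I] listed in
   increasing order; the default value of [nth] is then irrelevant. *)
Definition pluecker (n : nat) (v : 'I_n -> funAB R) (I : {fset AB}) : R[i] :=
  \det (\matrix_(r < n, s < n) (v r (nth (inl 0%N) (sort leAB I) s) : R[i])).

Definition has_type (a b : nat) (I : {fset AB}) : bool :=
  (#|` [fset i in I | inA i]%fset| == a) &&
  (#|` [fset i in I | ~~ inA i]%fset| == b).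

Definition block (n : nat) (v : 'I_n -> funAB R) (a b : nat)
  (I : {I : {fset AB} | has_type a b I}) : R[i] := pluecker v (val I).

(* Another basis of the same subspace multiplies all [pluecker v I] by a common
   nonzero scalar, so that this depends only on the span of [v]. *)
Definition prof (n : nat) (v : 'I_n -> funAB R) : set (nat * nat) :=
  [set ab | (ab.1 + ab.2 = n)%N /\ block v (a:=ab.1) (b:=ab.2) <> (fun=> 0)].

End Spaces.

(* Main.v *)
(** Let w_i in K^n be the row (v_r(i))_r.  Then p_I <> 0 iff the w_i, i in I, form
    a basis of K^n, and a combination of the v_r vanishes on B iff its
    coefficient vector is orthogonal to the span of the w_i, i in B; hence that
    span has dimension n - alpha, and likewise that of the A-columns has
    dimension n - gamma.  This bounds a on both sides.  Conversely, given such
    an a, take alpha of the A-columns forming a basis modulo the span of the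
    B-columns, extend them to a independent A-columns, and complete the result
    with B-columns to a basis of K^n. *)
Require Import Defs.
From mathcomp Require Import all_boot all_order all_algebra.
From mathcomp Require Import finmap complex.
From mathcomp Require Import all_classical all_reals all_analysis.

Import Order.TTheory GRing.Theory Num.Theory.

Local Open Scope classical_set_scope.
Local Open Scope ring_scope.
Local Open Scope complex_scope.

(** * Dimension of a subspace with a finite basis *)

Section Dimension.
Context {K : fieldType} {E : lmodType K}.
Implicit Types W : set E.

Lemma sum_mulmx (m d : nat) (c : 'rV[K]_m) (M : 'M[K]_(m, d)) (v : 'I_d -> E) :
  \sum_i c 0 i *: (\sum_j M i j *: v j) = \sum_j (c *m M) 0 j *: v j.
Proof.
under eq_bigr do rewrite scaler_sumr.
rewrite exchange_big; apply: eq_bigr => j _; rewrite !mxE scaler_suml.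
by apply: eq_bigr => i _; rewrite scalerA.
Qed.

(** Write each [v i] through [u] with coefficient matrix [A]. A row vector killing [A] gives a
    linear relation among the [v i], so the rows of [A] are independent and cannot outnumber its
    columns. *)
Lemma basis_leq W (d e : nat) (v : 'I_d -> E) (u : 'I_e -> E) :
  is_basis W v -> is_basis W u -> (d <= e)%N.
Proof.
move=> [v_free ->] [_ Vu].
have /choice[M vM] : forall i, exists c : 'I_e -> K, v i = \sum_j c j *: u j.
  move=> i; have : [set \sum_(j < d) c j *: v j | c in [set: 'I_d -> K]] (v i).
    exists (fun j => (j == i)%:R) => //.
    rewrite (bigD1 i) //= eqxx scale1r big1 ?addr0 // => j /negPf ->.
    by rewrite scale0r.
  by rewrite Vu => -[c _ <-]; exists c.
pose A := \matrix_(i, j) M i j.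
suff /eqP <- : row_free A by apply: rank_leq_col.
rewrite -kermx_eq0; apply/rowV0P => c /sub_kermxP cA0.
apply/rowP => i; rewrite mxE; apply: (v_free (c 0)).
under eq_bigr => k _.
  rewrite vM (eq_bigr (fun j => A k j *: u j)); last by move=> j _; rewrite mxE.
  over.
by rewrite sum_mulmx cA0 big1 // => j _; rewrite mxE scale0r.
Qed.

Lemma findim_basis W (d : nat) (v : 'I_d -> E) : is_basis W v -> findim W = d.
Proof.
move=> Wv; rewrite /findim; apply: xget_subset1; first by exists v.
move=> k l [u Wu] [t Wt]; apply/eqP.
by rewrite eqn_leq (basis_leq _ _ _ _ _ Wu Wt) (basis_leq _ _ _ _ _ Wt Wu).
Qed.

End Dimension.

(** Bridge from [free], which suits lists of columns, to matrix rank, which gives access to kernels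
    and determinants. *)
Lemma free_row_freeE {K : fieldType} (m k : nat) (X : k.-tuple 'rV[K]_m) :
  free X = row_free (\matrix_(i < k) X`_i).
Proof.
set M := \matrix_i _.
have rowM (c : 'I_k -> K) : \sum_i c i *: X`_i = (\row_i c i) *m M.
  by rewrite mulmx_sum_row; apply: eq_bigr => i _; rewrite mxE rowK.
apply/freeP/idP => [X_free|M_free c].
  rewrite -kermx_eq0; apply/rowV0P => c /sub_kermxP cM0.
  apply/rowP => i; rewrite mxE; apply: (X_free (c 0)).
  by rewrite rowM -[RHS]cM0; congr (_ *m _); apply/rowP => j; rewrite mxE.
rewrite rowM -[0](mul0mx _ M) => /(row_free_inj M_free)/rowP c0 i.
by have := c0 i; rewrite !mxE.
Qed.

(** * Columns: extension of free lists and vanishing combinations *)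

Section Columns.
Context {K : fieldType} {T : eqType} {n : nat} (v : 'I_n -> T -> K^o).

Definition column (i : T) : 'rV[K]_n := \row_r v r i.

Let w := column.

(** Greedy: append a column [w i] with [P i] outside the current span until none is left. The
    induction on [n - size X] works because a free family in K^n has at most n members. *)
Lemma free_extend (P : pred T) (X : seq 'rV[K]_n) : free X ->
  exists s, [/\ all P s, free (X ++ map w s) &
    forall i, P i -> w i \in <<X ++ map w s>>%VS].
Proof.
have [k] := ubnP (n - size X)%N; elim: k X => // k IH X /ltnSE Xk Xfree.
have [|/existsNP[i /not_implyP[Pi wiX]]] :=
    pselect (forall i, P i -> w i \in <<X>>%VS).
  by exists [::]; rewrite cats0.
have Xi_free : free (rcons X (w i)).
  rewrite -cats1 (perm_free (permEl (perm_catC _ _))) /= free_cons Xfree andbT.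
  exact/negP.
have Xi : (size X < n)%N.
  rewrite -(size_rcons X (w i)) -(eqP Xi_free).
  by have := dimvS (subvf <<rcons X (w i)>>%VS); rewrite dimvf /dim /= mul1n.
have [|s [Ps Xs_free Xs]] := IH (rcons X (w i)) _ Xi_free.
  by rewrite size_rcons; apply: leq_trans Xk; rewrite ltn_sub2l.
by exists (i :: s); rewrite /= Pi -cat_rcons.
Qed.

Lemma combination_columnE (c : 'rV[K]_n) i :
  (\sum_r c 0 r *: v r) i = (c *m (w i)^T) 0 0.
Proof. by rewrite fct_sumE mxE; apply: eq_bigr => r _; rewrite !mxE. Qed.

Definition vanishing (P : pred T) : set (T -> K^o) :=
  [set x | (exists c : 'I_n -> K, \sum_r c r *: v r = x) /\
           forall i, P i -> x i = 0].

Hypothesis v_free :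
  forall c : 'I_n -> K, \sum_r c r *: v r = 0 -> forall r, c r = 0.

(** Since the columns over [s] span all columns over [P], the coefficient vectors of combinations
    vanishing on [P] form the kernel of a matrix of rank [size s]. *)
Lemma findim_vanishing (P : pred T) (s : seq T) : all P s -> free (map w s) ->
  (forall i, P i -> w i \in <<map w s>>%VS) ->
  findim (vanishing P) = (n - size s)%N.
Proof.
move=> Ps s_free sP.
pose X := map_tuple w (in_tuple s); pose M := \matrix_(i < size s) X`_i.
have vanishE (c : 'rV[K]_n) :
    c *m M^T = 0 <-> forall i, P i -> (\sum_r c 0 r *: v r) i = 0.
  split=> [cM i /sP wi|c0].
    rewrite combination_columnE (@coord_span _ _ _ X _ wi) linear_sum.
    rewrite mulmx_sumr summxE big1 // => k _.
    rewrite linearZ -scalemxAr mxE.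
    have /rowP/(_ k) := cM; rewrite [RHS]mxE => cMk.
    rewrite [X in _ * X](_ : _ = 0) ?mulr0 // -cMk !mxE.
    by apply: eq_bigr => r _; rewrite !mxE.
  apply/rowP => k; rewrite [RHS]mxE.
  pose i := tnth (in_tuple s) k.
  have Pi : P i by exact: (elimT (all_tnthP (t := in_tuple s)) Ps).
  rewrite -(c0 i Pi) combination_columnE !mxE; apply: eq_bigr => r _.
  by rewrite !mxE -tnth_nth tnth_map mxE.
(* A basis of the kernel is transported to functions [u j]; freeness of [v] keeps them
   independent. *)
pose B := row_base (kermx M^T).
pose u j : T -> K^o := \sum_r B j r *: v r.
have rankB : \rank (kermx M^T) = (n - size s)%N.
  rewrite mxrank_ker mxrank_tr; congr (_ - _)%N.
  by apply/eqP; rewrite -[_ == _]/(row_free M) -free_row_freeE.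
rewrite -rankB; apply: (@findim_basis _ _ _ _ u); split.
  move=> c cu0.
  pose d := \row_i c i.
  have : d *m B = 0.
    apply/rowP => r; rewrite [RHS]mxE; apply: (v_free ((d *m B) 0)).
    by rewrite -sum_mulmx -[RHS]cu0; apply: eq_bigr => i _; rewrite mxE.
  rewrite -[0](mul0mx _ B) => /(row_free_inj (row_base_free _))/rowP d0 i.
  by have := d0 i; rewrite !mxE.
apply/seteqP; split=> x.
  move=> [[c <-] cP].
  pose d := \row_r c r.
  have dc : \sum_r c r *: v r = \sum_r d 0 r *: v r.
    by apply: eq_bigr => r _; rewrite mxE.
  have : d *m M^T = 0 by apply/vanishE => i Pi; rewrite -dc; apply: cP.
  move=> /sub_kermxP; rewrite -(eq_row_base (kermx M^T)) => /submxP[e de].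
  by exists (e 0) => //; rewrite dc de -sum_mulmx.
move=> [c _ <-].
pose d := \row_i c i.
have -> : \sum_j c j *: u j = \sum_r (d *m B) 0 r *: v r.
  by rewrite -sum_mulmx; apply: eq_bigr => i _; rewrite mxE.
split; first by exists ((d *m B) 0).
apply/vanishE; apply/sub_kermxP.
by rewrite -(eq_row_base (kermx M^T)) submxMl.
Qed.

(** No nonzero combination of the [v r] vanishes everywhere, so [findim_vanishing] for [xpredT]
    forces a maximal free list of columns to have n members. *)
Lemma columns_full (U : {vspace 'rV[K]_n}) : (forall i, w i \in U) -> \dim U = n.
Proof.
move=> wU.
have [s [_ s_free sT]] := @free_extend xpredT [::] (nil_free _).
have nsE := findim_vanishing _ _ (all_predT s) s_free sT.
have zeroE : findim (vanishing xpredT) = 0%N.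
  apply: (@findim_basis _ _ _ _ (fun=> 0)); split; first by move=> c _ [].
  apply/seteqP; split=> x.
    move=> [_ x0]; exists (fun=> 0) => //; rewrite big_ord0.
    by apply/funext => i; rewrite x0.
  move=> [c _ <-]; rewrite big_ord0; split=> //; exists (fun=> 0).
  by rewrite big1 // => r _; rewrite scale0r.
apply/eqP; rewrite eqn_leq; apply/andP; split.
  by have := dimvS (subvf U); rewrite dimvf /dim /= mul1n.
have : (n <= size s)%N by rewrite -subn_eq0 -nsE zeroE.
move=> /leq_trans; apply; rewrite -(size_map w) -(eqP s_free) dimvS //.
by apply/span_subvP => _ /mapP[i _ ->].
Qed.

Lemma free_size_leq (P : pred T) (s t : seq T) :
  (forall i, P i -> w i \in <<map w s>>%VS) -> all P t -> free (map w t) ->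
  (size t <= size s)%N.
Proof.
move=> sP /allP Pt /eqP t_free; rewrite -(size_map w t) -t_free.
rewrite -(size_map w s) (leq_trans _ (dim_span _)) // dimvS //.
by apply/span_subvP => _ /mapP[i /Pt Pi ->]; apply: sP.
Qed.

(** When [P] cuts out A and [s] spans the A-columns, [n - size t] is alpha and [size s] is n -
    gamma. *)
Lemma free_split (P : pred T) (s t : seq T) (a : nat) :
  all P s -> free (map w s) ->
  all (predC P) t -> free (map w t) ->
  (forall i, ~~ P i -> w i \in <<map w t>>%VS) ->
  (n - size t <= a <= size s)%N ->
  exists s' t', [/\ all P s', all (predC P) t', size s' = a,
    size t' = (n - a)%N & free (map w (s' ++ t'))].
Proof.
move=> Ps s_free Pt t_free tP /andP[ta as_].
(* [s1] is a basis of the [P]-columns modulo the span of the others, so it has [n - size t]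
   members. *)
have [s1 [Ps1 ts1_free ts1P]] := free_extend P _ t_free.
have ts1_full i : w i \in <<map w t ++ map w s1>>%VS.
  have [/ts1P//|/tP it] := boolP (P i).
  by rewrite span_cat; apply: subvP it; apply: addvSl.
have ts1 : (size t + size s1 = n)%N.
  by have := columns_full _ ts1_full; rewrite (eqP ts1_free) size_cat !size_map.
(* Now [t] is dropped and [s1] alone is extended to a basis of the span of the [P]-columns, which
   has at least [size s] members. *)
have [s2 [Ps2 s12_free s12P]] := free_extend P _ (catr_free ts1_free).
rewrite -map_cat in s12_free s12P.
have s_s12 := free_size_leq _ _ _ s12P Ps s_free.
have as12 : (a <= size (s1 ++ s2))%N by apply: leq_trans s_s12.
pose s' := take a (s1 ++ s2).
have s'_free : free (map w s').
  by move: s12_free; rewrite -[s1 ++ s2](cat_take_drop a) map_cat => /catl_free.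
have [t' [Pt' st_free st'P]] := free_extend (predC P) _ s'_free.
have Ps' : all P s'.
  have : all P (s1 ++ s2) by rewrite all_cat Ps1.
  by rewrite -[s1 ++ s2](cat_take_drop a) all_cat => /andP[].
have size_s' : size s' = a by rewrite size_takel.
exists s', t'; split=> //; last by rewrite map_cat.
(* The new list spans K^n: the columns outside [P] are in its span by [st'P], and [s1] is contained
   in [s'] because [size s1 <= a]. *)
suff st'_full i : w i \in <<map w s' ++ map w t'>>%VS.
  have := columns_full _ st'_full.
  by rewrite (eqP st_free) size_cat !size_map size_s' => <-; rewrite addKn.
apply: subvP (ts1_full i); rewrite span_cat subv_add; apply/andP; split.
  by apply/span_subvP => _ /mapP[j /(allP Pt) Pj ->]; apply: st'P.
rewrite span_cat; apply: subv_trans (addvSl _ _); apply: sub_span.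
move=> _ /mapP[j js1 ->].
have s1a : (size s1 <= a)%N by rewrite -(leq_add2l (size t)) ts1 -leq_subLR.
by apply: map_f; rewrite /s' take_cat ltnNge s1a /= mem_cat js1.
Qed.

End Columns.

(** * Pluecker coordinates and independence of columns *)

Section Pluecker.
Context {R : realType}.

Lemma card_fset_count (P : pred AB) (I : {fset AB}) :
  #|` [fset i in I | P i]%fset| = count P I.
Proof.
rewrite -size_filter; apply: perm_size; apply: uniq_perm => //.
  exact: filter_uniq.
by move=> i; rewrite !inE mem_filter andbC.
Qed.

Lemma has_typeE (a b : nat) (I : {fset AB}) :
  has_type a b I = (count inA I == a) && (count (predC inA) I == b).
Proof. by rewrite /has_type !card_fset_count. Qed.

(** Sorting [I] only permutes the columns, which does not affect freeness; the matrix with these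
    columns as rows is the transpose of the one in [pluecker]. *)
Lemma pluecker_neq0 (n : nat) (v : 'I_n -> funAB R) (I : {fset AB}) :
  #|` I| = n -> (pluecker v I != 0) = free (map (column v) I).
Proof.
move=> In.
have sizeI : size (map (column v) (sort leAB I)) == n.
  by rewrite size_map size_sort In.
have /perm_free <- : perm_eq (map (column v) (sort leAB I)) (map (column v) I).
  by apply: perm_map; rewrite perm_sort.
rewrite -[map _ _]/(val (Tuple sizeI)) free_row_freeE row_free_unit.
rewrite unitmxE unitfE -det_tr /pluecker; congr (\det _ != 0).
apply/matrixP => r s; rewrite !mxE (nth_map (inl 0%N)) ?mxE //.
by rewrite size_sort In.
Qed.

End Pluecker.

(** * The profile as an interval *)

Theorem theorem6p3 (R : realType) (p q : R) (n : nat)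
  (V : set (funAB R)) (v : 'I_n -> funAB R) :
  1 <= p -> p < q -> (1 <= n)%N ->
  GRing.submod_closed (mem V) -> V `<=` ell_sum p q ->
  is_basis V v ->
  prof v = [set (a, n - a)%N | a in
    [set a | findim (V `&` ellA p) <= a <= n - findim (V `&` ellB q)]%N].
Proof.
move=> _ _ _ _ Vpq [v_free VE].
pose w := column v.
have memV c : V (\sum_r c r *: v r) by rewrite VE; exists c.
(* Summability on A is inherited from [Vpq], so membership in [ellA p] reduces to vanishing on B. *)
have VA : V `&` ellA p = vanishing v (predC inA).
  apply/seteqP; split=> x.
    by rewrite {1}VE => -[[c _ <-] [_ cB]]; split; [exists c | case].
  move=> [[c <-] cB]; split=> //; split; first by have [] := Vpq _ (memV c).
  by move=> k; apply: cB.
have VB : V `&` ellB q = vanishing v inA.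
  apply/seteqP; split=> x.
    by rewrite {1}VE => -[[c _ <-] [cA _]]; split; [exists c | case].
  move=> [[c <-] cA]; split=> //; split; last by have [] := Vpq _ (memV c).
  by move=> k; apply: cA.
(* Bases [s] for the A-columns and [t] for the B-columns, of sizes n - gamma and n - alpha. *)
have [s [sA s_free sP]] := free_extend v inA _ (nil_free _).
have [t [tB t_free tP]] := free_extend v (predC inA) _ (nil_free _).
have size_s_n : (size s <= n)%N.
  rewrite -(size_map w s) -(eqP s_free).
  by have := dimvS (subvf <<map w s>>%VS); rewrite dimvf /dim /= mul1n.
rewrite VA VB (findim_vanishing _ v_free _ _ tB t_free tP).
rewrite (findim_vanishing _ v_free _ _ sA s_free sP) subKn //.
apply/seteqP; split=> [[a b] /= [abn]|_ [a /= a_st <-]].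
  move=> /eqP/eqP block_neq0.
  (* A nonzero block is nonzero at some [I], whose columns split into free lists of a A-columns and
     b B-columns. *)
  have [[I Itype] pI] : exists I, block v (a:=a) (b:=b) I != 0.
    apply: contrapT => block0; apply: block_neq0; apply/funext => I.
    by apply/eqP/negPn/negP => pI; apply: block0; exists I.
  move: pI; rewrite /block /=.
  move: Itype; rewrite has_typeE => /andP[/eqP Ia /eqP Ib].
  have In : #|` I| = n by rewrite -(count_predC inA) Ia Ib.
  rewrite pluecker_neq0 // => I_free.
  have filters_free :
      free (map w [seq i <- I | inA i] ++ map w [seq i <- I | predC inA i]).
    by rewrite -map_cat (perm_free (perm_map _ (permEl (perm_filterC _ _)))).
  have as_ : (a <= size s)%N.
    rewrite -Ia -size_filter.
    by apply: (free_size_leq v _ _ _ sP (filter_all _ _) (catl_free filters_free)).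
  have bt : (b <= size t)%N.
    rewrite -Ib -size_filter.
    by apply: (free_size_leq v _ _ _ tP (filter_all _ _) (catr_free filters_free)).
  exists a; last by rewrite -abn addKn.
  (* As a + b = n, the bound [b <= size t] is the lower bound on a. *)
  by rewrite as_ -abn leq_subLR addnC leq_add2r bt.
have [s' [t' [s'A t'B size_s' size_t' st_free]]] :=
  free_split _ v_free _ _ _ _ sA s_free tB t_free tP a_st.
have an : (a <= n)%N by case/andP: a_st => _ /leq_trans; apply.
split; first by rewrite subnKC.
(* A repeated index would repeat a column, so by freeness the set [I] keeps all n indices. *)
have st_uniq : uniq (s' ++ t') by apply: map_uniq (free_uniq st_free).
pose I := [fset i in s' ++ t']%fset.
have I_perm : perm_eq I (s' ++ t').
  apply: uniq_perm => [||i]; [exact: fset_uniq|exact: st_uniq|].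
  by rewrite in_fset.
have Itype : has_type a (n - a) I.
  rewrite has_typeE !(permP I_perm) !count_cat.
  have -> : count inA t' = 0%N.
    by apply/eqP; rewrite -leqn0 leqNgt -has_count -all_predC.
  have -> : count (predC inA) s' = 0%N.
    by apply/eqP; rewrite -leqn0 leqNgt -has_count has_predC s'A.
  move: s'A t'B; rewrite !all_count => /eqP -> /eqP ->.
  by rewrite size_s' size_t' addn0 !eqxx.
have In : #|` I| = n by rewrite (perm_size I_perm) size_cat size_s' size_t' subnKC.
move=> /(congr1 (fun f => f (exist _ I Itype))) /eqP; apply/negP.
by rewrite /block /= pluecker_neq0 // (perm_free (perm_map _ I_perm)).
Qed.
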